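(* Let $n, a, b$ be positive integers with $\gcd(a,b)=1$. If $\gcd(n!,b)=1$ and $a+b>\prod_{p\le n}p^{\lfloor \log_p n\rfloor}$, then there exist integers $a_1,\dots,a_n$ with $a_i>1$ for every $1\le i\le n$ such that $$\frac{(a+b)(a+2b)\cdots(a+nb)}{1\cdot 2\cdots n}=\prod_{i=1}^{n}a_i,$$ where $a_i\mid (a+bi)$ for every $1\le i\le n$, and $\gcd(a_i,a_j)=1$ for all $1\le i\ne j\le n$. Consequently, under these hypotheses, $\prod_{i=1}^{n}(a+bi)$ has $n$ distinct prime factors (that is, at least $n$ distinct primes divide it).
   Context: In the product $\prod_{p\le n}p^{\lfloor \log_p n\rfloor}$, the index $p$ runs over all prime numbers $p\le n$ (the empty product is $1$), and $\lfloor\cdot\rfloor$ denotes the integer part. *)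

(* Defs.v *)
From mathcomp Require Export all_boot all_order all_algebra.

(* Main.v *)
Require Import Defs.
From mathcomp Require Import all_boot all_order all_algebra.
From mathcomp Require Import zify.

(** The identity is a statement about [p]-adic valuations, one prime [p] at a
    time. Write [P] for the product of the terms [a + b * i], [1 <= i <= n],
    and let [m] be an index at which the valuation of [a + b * i] is maximal
    (the peak of [p]). All the [p]-power of [P / n!] is given to the single
    factor [c m]:
      [c i] is the product of [p ^ (logn p P - logn p n`!)] over the primes
      [p] whose peak is [i].
    Distinct [c i] then involve disjoint sets of primes, so they are pairwise
    coprime, and their product is [P / n!].

    The rest comes from counting. For [q] coprime to [b], the number of terms
    divisible by [q] is the floor of [n / q] or that floor plus one
    ([count_dvd_prog]). Summed over the powers [q] of a prime [p] not dividing
    [b], with [v] the valuation of the term at the peak, this gives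
    - [logn p n`! <= logn p P]: the quotient [P / n!] is an integer;
    - [logn p P <= logn p n`! + v]: a power of [p] dividing some term divides
      the peak term, and only then can the extra one occur; so [c m] divides
      [a + b * m];
    - [logn p n`! + v <= logn p P + trunc_log p n]: at the peak, dividing
      [a + b * m] by [c m] leaves at most [p ^ trunc_log p n]. The same bound
      holds away from the peak, where a power of [p] dividing [a + b * i] also
      divides the difference [i - m].
    If [p] divides [b], then [p] divides neither [n!] nor any term, and there
    is nothing to prove. Hence [(a + b * i) / c i] divides the product of the
    [p ^ trunc_log p n], which is smaller than [a + b] by hypothesis, and
    [c i > 1] follows. A prime factor of each [c i] provides [n] distinct prime
    factors of [P]. *)

(** * Valuations as sums of divisibility indicators *)

Lemma sum_leq_indicator t K :
  \sum_(1 <= k < K.+1) (k <= t : nat) = minn t K.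
Proof.
elim: K => [|K IH]; first by rewrite big_nil minn0.
by rewrite big_nat_recr //= IH; case: leqP; lia.
Qed.

Lemma logn_indicator p x K : prime p -> 0 < x -> logn p x <= K ->
  logn p x = \sum_(1 <= k < K.+1) (p ^ k %| x).
Proof.
move=> pp x0 /minn_idPl {1}<-; rewrite -sum_leq_indicator.
by apply: eq_bigr => k _; rewrite pfactor_dvdn.
Qed.

Lemma logn_prod_seq (p : nat) (I : eqType) (s : seq I) (F : I -> nat) :
  (forall i, i \in s -> 0 < F i) ->
  logn p (\prod_(i <- s) F i) = \sum_(i <- s) logn p (F i).
Proof.
elim: s => [|i s IH] F0; first by rewrite !big_nil logn1.
rewrite !big_cons lognM ?IH //.
- by move=> j js; apply: F0; rewrite inE js orbT.
- by apply: F0; rewrite inE eqxx.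
- by rewrite big_seq; apply: prodn_cond_gt0 => j js; apply: F0;
    rewrite inE js orbT.
Qed.

(** The form in which a valuation becomes a count: exchanging the two sums
    leaves, for each [k], the number of factors divisible by [p ^ k]. *)
Lemma logn_prod_count p n (F : nat -> nat) K : prime p ->
  (forall i, 0 < i <= n -> 0 < F i) ->
  logn p (\prod_(1 <= i < n.+1) F i) <= K ->
  logn p (\prod_(1 <= i < n.+1) F i)
  = \sum_(1 <= k < K.+1) \sum_(1 <= i < n.+1) (p ^ k %| F i).
Proof.
move=> pp F0; rewrite logn_prod_seq; last first.
  by move=> i; rewrite mem_index_iota ltnS => /F0.
move=> leK; rewrite exchange_big /=; apply: eq_big_seq => i ir.
apply: logn_indicator => //.
  by apply: F0; rewrite mem_index_iota ltnS in ir.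
by apply: leq_trans leK; rewrite (big_rem i ir) /= leq_addr.
Qed.

Lemma logn_prod_primes q (s : seq nat) (e : nat -> nat) : uniq s ->
  logn q (\prod_(p <- s | prime p) p ^ e p)
  = if prime q && (q \in s) then e q else 0.
Proof.
move=> us; rewrite -big_filter logn_prod_seq => [|p]; last first.
  by rewrite mem_filter => /andP[pp _]; rewrite expn_gt0 prime_gt0.
have -> : prime q && (q \in s) = (q \in filter prime s) by rewrite mem_filter.
have uf := filter_uniq prime us.
have E p : p \in filter prime s -> logn q (p ^ e p) = (q == p) * e p.
  rewrite mem_filter => /andP[pp _].
  by rewrite lognX logn_prime // mulnC eq_sym.
rewrite (eq_big_seq _ E); case: ifP => qs.
  rewrite (bigD1_seq q) //= eqxx mul1n big1 ?addn0 // => p.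
  by rewrite eq_sym => /negPf->.
by rewrite big_seq big1 // => p ps; case: eqP => // E'; rewrite E' ps in qs.
Qed.

Lemma dvdn_logn m n : 0 < m -> 0 < n ->
  (forall p, prime p -> logn p m <= logn p n) -> m %| n.
Proof.
move=> m0 n0 H; apply/dvdn_partP => // p.
by rewrite mem_primes => /and3P[pp _ _]; rewrite p_part pfactor_dvdn // H.
Qed.

(** * Terms of an arithmetic progression divisible by a given integer *)

Lemma count_dvd_shift q s n : 0 < q ->
  \sum_(1 <= i < n.+1) (q %| i + s) = (n + s) %/ q - s %/ q.
Proof.
move=> q0; elim: n => [|n IH]; first by rewrite big_nil subnn.
rewrite big_nat_recr //= IH addSn divnS //.
by have := leq_div2r q (leq_addl n s); lia.
Qed.

(** Multiplying by an inverse of [b] modulo [q] reduces the progression to a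
    translate of the integers. *)
Lemma dvd_prog_shift q a b : 0 < q -> coprime q b ->
  exists2 s, s < q & forall i, (q %| a + b * i) = (q %| i + s).
Proof.
move=> q0 cqb; case: (posnP b) => [b0|b0].
  (* here [q = 1] *)
  move: cqb; rewrite b0 /coprime gcdn0 => /eqP->.
  by exists 0 => // i; rewrite !dvd1n.
have [u v E _] := egcdnP q b0.
have cuq : coprime q u.
  have : coprime q (u * b).
    move: E; rewrite gcdnC (eqP cqb) => ->.
    by rewrite /coprime gcdnMDl gcdn1.
  by rewrite coprimeMr => /andP[].
exists ((u * a) %% q); first by rewrite ltn_mod.
move=> i; rewrite -(Gauss_dvdr _ cuq) mulnDr mulnA E gcdnC (eqP cqb).
rewrite mulnDl mul1n mulnAC addnCA dvdn_addr ?dvdn_mull //.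
by rewrite addnC /dvdn modnDmr.
Qed.

Lemma count_dvd_prog q a b n : 0 < q -> coprime q b ->
  n %/ q <= \sum_(1 <= i < n.+1) (q %| a + b * i) <= (n %/ q).+1.
Proof.
move=> q0 /(dvd_prog_shift _ a)-/(_ q0)[s sq E].
under eq_bigr => i _ do rewrite E.
rewrite count_dvd_shift // (divn_small sq) subn0.
rewrite leq_div2r ?leq_addr //=.
apply: (@leq_trans ((n + q) %/ q)); first by rewrite leq_div2r // leq_add2l ltnW.
by rewrite divnDr ?dvdnn // divnn q0 addn1.
Qed.

(** Such a [q] divides [b * (j - i)], hence the nonzero difference of the two
    indices. *)
Lemma dvd_prog_close q a b i j n : coprime q b ->
  0 < i <= n -> 0 < j <= n -> i <> j ->
  q %| a + b * i -> q %| a + b * j -> q <= n.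
Proof.
move=> cqb; wlog lij : i j / i < j.
  move=> W hi hj ne di dj; case: (ltngtP i j) => // l.
    exact: (W i j).
  by apply: (W j i) => //; move/esym.
move=> hi hj _ di dj.
have : q %| b * (j - i).
  by rewrite mulnBr -(subnDl a) dvdn_sub.
rewrite Gauss_dvdr // => /dvdn_leq; lia.
Qed.

(** * The peak of a prime *)

(** The maximum is taken over ['I_n.+1] restricted to positive indices, which
    gives a default when [n = 0] and avoids shifting the index. *)
Definition peak (f : nat -> nat) n : nat :=
  [arg max_(i > ord_max : 'I_n.+1 | 0 < i) f i].

Lemma peakP f n : 0 < n ->
  0 < peak f n <= n /\ forall i, 0 < i <= n -> f i <= f (peak f n).
Proof.
move=> n0; rewrite /peak; case: arg_maxnP => //= m m0 H; split.
  by rewrite m0 -ltnS ltn_ord.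
move=> i /andP[i0 il]; have il' : i < n.+1 by [].
exact: (H (Ordinal il')).
Qed.

(** The three comparisons hold power by power: for each [k] they compare
    numbers of terms divisible by [p ^ k], and are then summed over [k]. *)
Lemma logn_prog_bounds p n a b m : prime p -> 0 < a -> coprime p b ->
  0 < m <= n ->
  (forall i, 0 < i <= n -> logn p (a + b * i) <= logn p (a + b * m)) ->
  let P := \prod_(1 <= i < n.+1) (a + b * i) in
  [/\ logn p n`! <= logn p P,
      logn p P <= logn p n`! + logn p (a + b * m) &
      logn p n`! + logn p (a + b * m) <= logn p P + trunc_log p n].
Proof.
move=> pp a0 cpb hm Hm P.
have t0 i : 0 < a + b * i by rewrite addn_gt0 a0.
pose K := logn p P + logn p n`! + logn p (a + b * m).
pose N k := \sum_(1 <= i < n.+1) (p ^ k %| a + b * i).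
have EP : logn p P = \sum_(1 <= k < K.+1) N k.
  by apply: logn_prod_count => //; rewrite /K -addnA leq_addr.
have EF : logn p n`! = \sum_(1 <= k < K.+1) n %/ p ^ k.
  rewrite fact_prod (@logn_prod_count _ _ _ K) //.
  - apply: eq_bigr => k _; rewrite -[in RHS](addn0 n).
    have q0 : 0 < p ^ k by rewrite expn_gt0 prime_gt0.
    have := count_dvd_shift (p ^ k) 0 n q0.
    rewrite div0n subn0 => <-.
    by apply: eq_bigr => i _; rewrite addn0.
  - by move=> i /andP[].
  - by rewrite -fact_prod /K addnAC leq_addl.
have EM : logn p (a + b * m) = \sum_(1 <= k < K.+1) (p ^ k %| a + b * m).
  by apply: logn_indicator => //; rewrite /K leq_addl.
have NB k : n %/ p ^ k <= N k <= (n %/ p ^ k).+1.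
  by apply: count_dvd_prog; rewrite ?expn_gt0 ?prime_gt0 ?coprimeXl.
have mr : m \in index_iota 1 n.+1 by rewrite mem_index_iota ltnS.
split.
- by rewrite EP EF; apply: leq_sum => k _; case/andP: (NB k).
- rewrite EP EF EM -big_split /=; apply: leq_sum => k _.
  case: (boolP (_ %| _)) => [_|ndv]; first by rewrite addn1; case/andP: (NB k).
  (* a power of [p] not dividing the peak term divides no term *)
  rewrite [N k]big_seq big1 // => i; rewrite mem_index_iota ltnS => /Hm le.
  case: (boolP (_ %| _)) => // dv; case/negP: ndv; move: dv.
  by rewrite !pfactor_dvdn // => /leq_trans; apply.
- have TL : \sum_(1 <= k < K.+1) (k <= trunc_log p n : nat) <= trunc_log p n.
    by rewrite sum_leq_indicator geq_minl.
  apply: leq_trans (leq_add (leqnn _) TL).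
  rewrite EP EF EM -!big_split /=; apply: leq_sum => k _.
  have [le|gt] := leqP (p ^ k) n.
    rewrite (trunc_log_max (prime_gt1 pp) le).
    by apply: leq_add; [case/andP: (NB k) | case: (_ %| _)].
  (* no positive integer up to [n] is divisible by [p ^ k], but the peak term
     may be, and it is then counted in [N k] *)
  rewrite (divn_small gt) add0n; apply: leq_trans (leq_addr _ _).
  by rewrite /N (big_rem m mr) /= leq_addr.
Qed.

(** * The factors *)

Section Factors.

Variables n a b : nat.
Hypotheses (n_gt0 : 0 < n) (a_gt0 : 0 < a).
Hypotheses (coprime_ab : coprime a b) (coprime_fact : coprime n`! b).

Let term i := a + b * i.
Let P := \prod_(1 <= i < n.+1) term i.
Let pk p := peak (fun i => logn p (term i)) n.
Let excess (i p : nat) := if i == pk p then logn p P - logn p n`! else 0.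

(* The range of [p] only needs to contain every prime factor of [P]. *)
Let factor (i : nat) := \prod_(1 <= p < P.+1 | prime p) p ^ excess i p.

Let term_gt0 i : 0 < term i.
Proof. by rewrite addn_gt0 a_gt0. Qed.

Let P_gt0 : 0 < P.
Proof. by rewrite prodn_gt0. Qed.

Let factor_gt0 i : 0 < factor i.
Proof. by apply: prodn_cond_gt0 => p pp; rewrite expn_gt0 prime_gt0. Qed.

Lemma pk_range p : 0 < pk p <= n.
Proof. by case: (peakP (fun i => logn p (term i)) n n_gt0). Qed.

Lemma logn_factor p i : prime p -> logn p (factor i) = excess i p.
Proof.
move=> pp; rewrite logn_prod_primes ?iota_uniq // pp mem_index_iota.
rewrite prime_gt0 //= ltnS; case: leqP => // gtP.
have l0 : logn p P = 0.
  rewrite lognE pp P_gt0 /=; case: ifP => // /dvdn_leq.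
  by move/(_ P_gt0); rewrite leqNgt gtP.
by rewrite /excess l0 sub0n if_same.
Qed.

(** [logn_prog_bounds] at the peak, extended to the primes dividing [b]: every
    valuation in it vanishes for these. *)
Lemma peak_bounds p : prime p ->
  [/\ logn p n`! <= logn p P,
      logn p P <= logn p n`! + logn p (term (pk p)) &
      logn p n`! + logn p (term (pk p)) <= logn p P + trunc_log p n].
Proof.
move=> pp; case: (boolP (coprime p b)) => [cpb|].
  have [hm Hm] := peakP (fun i => logn p (term i)) n n_gt0.
  exact: logn_prog_bounds.
rewrite prime_coprime // negbK => pb.
have ndvd x : coprime x b -> logn p x = 0.
  move=> cx; apply/eqP; rewrite logn_coprime // prime_coprime //.
  by apply/negP => px; have := dvdn_gcd p x b; rewrite px pb (eqP cx) dvdn1;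
    case: eqP pp => // ->.
have ct i : coprime (term i) b.
  by rewrite /term /coprime gcdnC addnC (mulnC b) gcdnMDl gcdnC.
have cP : coprime P b.
  apply: (big_ind (fun x => coprime x b)) => //; first exact: coprime1n.
  by move=> x y cx cy; rewrite coprimeMl cx.
by rewrite !ndvd.
Qed.

Lemma excess_leq i p : prime p -> excess i p <= logn p (term i).
Proof.
move=> pp; rewrite /excess; case: eqP => // ->.
by have [_ ? _] := peak_bounds p pp; rewrite leq_subLR.
Qed.

(** Away from the peak, the whole power of [p] in [term i] also divides the
    peak term, and [dvd_prog_close] bounds it by [n]. *)
Lemma excess_geq i p : prime p -> 0 < i <= n ->
  logn p (term i) <= excess i p + trunc_log p n.
Proof.
move=> pp hi; rewrite /excess; case: eqP => [->|ne].
  by have [? ? ?] := peak_bounds p pp; lia.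
rewrite add0n; apply: trunc_log_max (prime_gt1 pp) _.
have [->|l0] := posnP (logn p (term i)); first exact: n_gt0.
have [_ /(_ i hi) Hm] := peakP (fun i => logn p (term i)) n n_gt0.
apply: (dvd_prog_close _ a b i (pk p) n _ hi (pk_range p) ne); last 2 first.
- by rewrite pfactor_dvdn // term_gt0.
- by rewrite pfactor_dvdn // term_gt0.
apply: coprimeXl; rewrite prime_coprime //; apply/negP => pb.
have pt : p %| a + b * i by move: l0; rewrite logn_gt0 mem_primes => /and3P[].
have pa : p %| a by rewrite -(dvdn_addl _ (dvdn_mulr i pb)).
have := dvdn_gcd p a b; rewrite pa pb (eqP coprime_ab) dvdn1.
by case: eqP pp => // ->.
Qed.

Lemma factor_dvd i : factor i %| term i.
Proof. by apply: dvdn_logn => // p pp; rewrite logn_factor // excess_leq. Qed.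

(** Each prime contributes its excess exactly once, at its peak. *)
Lemma prod_factor : P = (\prod_(1 <= i < n.+1) factor i) * n`!.
Proof.
have Q0 : 0 < \prod_(1 <= i < n.+1) factor i by rewrite prodn_gt0.
apply: eqn_from_log => [||p]; rewrite ?muln_gt0 ?Q0 ?fact_gt0 //.
rewrite lognM ?fact_gt0 //.
case: (boolP (prime p)) => [pp|/negPf np]; last first.
  have Z x : logn p x = 0 by rewrite lognE np.
  by rewrite !Z.
rewrite (logn_prod_seq p _ _ factor) // (bigD1_seq (pk p)) ?iota_uniq //=; last first.
  by rewrite mem_index_iota ltnS pk_range.
rewrite logn_factor // /excess eqxx big1 => [|i /negPf ne]; last first.
  by rewrite logn_factor // /excess ne.
by rewrite addn0 subnK //; case: (peak_bounds p pp).
Qed.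

Lemma factor_coprime i j : i <> j -> coprime (factor i) (factor j).
Proof.
move=> ne; rewrite coprime_has_primes //; apply/hasPn => p.
move=> pj; have pp : prime p by move: pj; rewrite mem_primes; case/andP.
move: pj; rewrite /= -!logn_gt0 !logn_factor // /excess.
by case: eqP => // ej _; case: eqP => // ei; case: ne; rewrite ei ej.
Qed.

Let D := \prod_(1 <= p < n.+1 | prime p) p ^ trunc_log p n.

Lemma term_dvd i : 0 < i <= n -> term i %| factor i * D.
Proof.
move=> hi.
have D0 : 0 < D by apply: prodn_cond_gt0 => p pp; rewrite expn_gt0 prime_gt0.
apply: dvdn_logn; rewrite ?muln_gt0 ?factor_gt0 // => p pp.
rewrite lognM // logn_factor // logn_prod_primes ?iota_uniq // pp.
rewrite mem_index_iota prime_gt0 //= ltnS.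
case: (leqP p n) => [_|ltnp]; first exact: excess_geq.
suff /eqP <- : trunc_log p n == 0 by exact: excess_geq.
by rewrite trunc_log_eq0 -(ltnS n) prednK ?prime_gt0 // ltnp orbT.
Qed.

(** If [factor i] were [1], the whole term would divide [D], which is smaller
    than [a + b]. *)
Lemma factor_gt1 i : D < a + b -> 0 < i <= n -> 1 < factor i.
Proof.
move=> hD hi; rewrite ltn_neqAle factor_gt0 andbT eq_sym; apply/eqP => E.
have := term_dvd i hi; rewrite E mul1n => /dvdn_leq.
have D0 : 0 < D by apply: prodn_cond_gt0 => p pp; rewrite expn_gt0 prime_gt0.
move/(_ D0); apply/negP; rewrite -ltnNge; apply: leq_trans hD _.
by rewrite leq_add2l leq_pmulr; case/andP: hi.
Qed.

Lemma exists_coprime_factors : D < a + b ->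
  exists c : nat -> nat,
    [/\ forall i, 0 < i <= n -> 1 < c i,
        \prod_(1 <= i < n.+1) (a + b * i)
          = (\prod_(1 <= i < n.+1) c i) * n`!,
        forall i, c i %| a + b * i
      & forall i j, i <> j -> coprime (c i) (c j)].
Proof.
move=> hD; exists factor; split.
- by move=> i; apply: factor_gt1.
- exact: prod_factor.
- exact: factor_dvd.
- exact: factor_coprime.
Qed.

End Factors.

(** The least prime factors of the [c i] are distinct by coprimality. *)
Lemma size_primes_prod_coprime n (c t : nat -> nat) :
  (forall i, 0 < i <= n -> 1 < c i) ->
  (forall i, 0 < i <= n -> c i %| t i) -> (forall i, 0 < t i) ->
  (forall i j, i <> j -> coprime (c i) (c j)) ->
  n <= size (primes (\prod_(1 <= i < n.+1) t i)).
Proof.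
move=> c1 cd t0 cc.
rewrite -[n in n <= _](size_iota 1) -(size_map (pdiv \o c)).
have mi i : i \in iota 1 n -> 0 < i <= n by rewrite mem_iota add1n ltnS.
apply: uniq_leq_size.
  rewrite map_inj_in_uniq ?iota_uniq // => i j /mi hi _ /= E.
  apply/eqP; apply: contraT => /eqP /cc cij.
  have := dvdn_gcd (pdiv (c i)) (c i) (c j).
  rewrite {3}E !pdiv_dvd (eqP cij) dvdn1.
  by case: eqP (pdiv_prime (c1 i hi)) => // ->.
move=> p /mapP[i is_ ->] /=; have hi := mi i is_.
rewrite mem_primes pdiv_prime ?c1 // prodn_gt0 //=.
apply: dvdn_trans (pdiv_dvd _) _; apply: dvdn_trans (cd i hi) _.
rewrite (big_rem i) /= ?dvdn_mulr //.
by rewrite mem_index_iota ltnS.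
Qed.

Theorem theorem3 (n a b : nat) (hn : 0 < n) (ha : 0 < a) (hb : 0 < b)
    (hab : gcdn a b = 1) (hnb : gcdn n`! b = 1)
    (hlarge : a + b > \prod_(1 <= p < n.+1 | prime p) p ^ trunc_log p n) :
  (exists c : nat -> nat,
     [/\ forall i, 1 <= i <= n -> 1 < c i,
         ((\prod_(1 <= i < n.+1) (a + b * i))%N%:R
            / (\prod_(1 <= i < n.+1) i)%N%:R
          = (\prod_(1 <= i < n.+1) c i)%N%:R :> rat)%R,
         forall i, 1 <= i <= n -> c i %| a + b * i
       & forall i j, 1 <= i <= n -> 1 <= j <= n -> i <> j ->
           gcdn (c i) (c j) = 1])
  /\ n <= size (primes (\prod_(1 <= i < n.+1) (a + b * i))).
Proof.
have [c [c1 cP cd cc]] :=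
  exists_coprime_factors n a b hn ha (introT eqP hab) (introT eqP hnb) hlarge.
split; last first.
  apply: (@size_primes_prod_coprime n c) => // i.
  by rewrite addn_gt0 ha.
exists c; split=> //; last by move=> i j _ _ /cc /eqP.
rewrite cP -fact_prod GRing.natrM GRing.mulfK //.
by rewrite Num.Theory.pnatr_eq0 -lt0n fact_gt0.
Qed.
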